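(* Let $X\subseteq U$ be a fixed set of $|X|=m$ keys and let $h:U\to[n]$ be a random simple tabulation hash function. For all $t\ge0$, $$\Pr\bigl[|h(X)|\ge \mu_0+2t\bigr]=O\!\left(\exp\!\left(\frac{-t^2}{2m^{2-1/c}}\right)\right),$$ and $$\Pr\bigl[|h(X)|\le \mu_0-2t\bigr]=O\!\left(\exp\!\left(\frac{-t^2}{2m^{2-1/c}}\right)+\frac{m^2}{nt^2}\right).$$
   Context: Simple tabulation hashing: the key universe is $U=[u]$, each key $x\in U$ is viewed as a vector $(x[0],\dots,x[c-1])$ of $c=O(1)$ characters from $\Sigma=[u^{1/c}]$; the range is $[n]=[2^r]$. $h(x)=h_0(x[0])\oplus\cdots\oplus h_{c-1}(x[c-1])$ with $h_0,\dots,h_{c-1}:\Sigma\to[2^r]$ independent fully random functions and $\oplus$ bitwise XOR. $\mu_0=n(1-(1-1/n)^m)$. The constants in $O(\cdot)$ may depend on $c$ only. *)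

(* Defs.v *)
From mathcomp Require Import all_boot all_order all_algebra.
From mathcomp Require Import all_classical all_reals all_analysis.
Set Implicit Arguments. Unset Strict Implicit. Unset Printing Implicit Defensive.
Import Order.TTheory GRing.Theory Num.Theory.
Local Open Scope ring_scope.

(* Keys: vectors of c characters from Sigma = [sigma]; universe U = Sigma^c. *)
Definition key (c sigma : nat) := {ffun 'I_c -> 'I_sigma}.

(* Hash values in [2^r], represented as r-bit vectors (bitwise XOR = addb). *)
Definition hval (r : nat) := {ffun 'I_r -> bool}.

Definition hxor (r : nat) (a b : hval r) : hval r := [ffun j => addb (a j) (b j)].
Definition hzero (r : nat) : hval r := [ffun _ => false].

(* A simple tabulation hash function: c character tables h_0..h_{c-1}. *)
Definition tabfun (c sigma r : nat) := {ffun 'I_c -> {ffun 'I_sigma -> hval r}}.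

Definition tab_hash (c sigma r : nat) (T : tabfun c sigma r) (x : key c sigma) : hval r :=
  \big[@hxor r/hzero r]_(i < c) T i (x i).

Definition image_size (c sigma r : nat) (T : tabfun c sigma r) (X : {set key c sigma}) : nat :=
  #|[set tab_hash T x | x in X]|.

(* Probability over uniformly random (fully random, independent) tables. *)
Definition Pr_tab (R : realType) (c sigma r : nat) (E : pred (tabfun c sigma r)) : R :=
  (#|[set T | E T]|%:R / #|{: tabfun c sigma r}|%:R)%R.

Definition mu0 (R : realType) (n m : nat) : R :=
  (n%:R * (1 - (1 - n%:R^-1) ^+ m))%R.

(* Main.v *)
Require Import Defs.
From mathcomp Require Import all_boot all_order all_algebra.
From mathcomp Require Import all_classical all_reals all_analysis.
From mathcomp Require Import ring lra.
Set Implicit Arguments. Unset Strict Implicit. Unset Printing Implicit Defensive.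
Import Order.TTheory GRing.Theory Num.Theory.
Import numFieldNormedType.Exports.
Local Open Scope ring_scope.

(** Order the position characters so that each group, the keys of [X] whose
    last character is a given one, has at most [m^(1-1/c)] keys; the squared
    group sizes then sum to at most [S = m^(2-1/c)].  Hash the groups one
    after the other.  The last table entry of a group translates its [d]
    distinct values by a uniform vector, so a fraction [d/n] of the empty bins
    gets filled on average, with fluctuation at most [d], and an Azuma-type
    exponential moment argument controls the deviation.  The two errors with
    respect to [mu0] are the gap between [1 - k/n] and [(1 - 1/n)^k], of total
    size at most [S/n], and, for the lower tail only, the collisions inside
    groups.  Their number has mean at most [S/n] and variance [O(m^2/n)]: two
    collision events are uncorrelated unless the four keys involved cancel
    character by character, and there are at most [3^c m^2] such quadruples.
    When [S < n^2] the bias [S/n] is below [sqrt S], hence harmless; otherwise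
    both bounds are trivial. *)

(** * Averages over a finite type *)

Definition avg (R : realType) (I : finType) (F : I -> R) : R :=
  (\sum_i F i) / #|I|%:R.

Section Average.
Context {R : realType} {I : finType}.
Implicit Types F G : I -> R.

Lemma eq_avg F G : F =1 G -> avg F = avg G.
Proof. by move=> FG; rewrite /avg; congr (_ / _); apply: eq_bigr. Qed.

Lemma ler_avg F G : (forall i, F i <= G i) -> avg F <= avg G.
Proof. by move=> FG; rewrite ler_wpM2r ?invr_ge0// ler_sum. Qed.

Lemma avgD F G : avg (fun i => F i + G i) = avg F + avg G.
Proof. by rewrite /avg big_split mulrDl. Qed.

Lemma avgZ (a : R) F : avg (fun i => a * F i) = a * avg F.
Proof. by rewrite /avg -mulr_sumr mulrA. Qed.

Lemma avg_sum (J : finType) (P : pred J) (F : J -> I -> R) :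
  avg (fun i => \sum_(j | P j) F j i) = \sum_(j | P j) avg (F j).
Proof. by rewrite /avg exchange_big/= -mulr_suml. Qed.

Lemma avg_cst (a : R) : (0 < #|I|)%N -> avg (fun _ : I => a) = a.
Proof.
move=> I0; rewrite /avg sumr_const -[a *+ _]mulr_natr mulfK//.
by rewrite pnatr_eq0 -lt0n.
Qed.

Lemma avg_le_cst (a : R) F : 0 <= a -> (forall i, F i <= a) -> avg F <= a.
Proof.
move=> a0 Fa; have [I0|] := ltnP 0 #|I|.
  by rewrite -[leRHS](avg_cst a I0) ler_avg.
by rewrite leqn0 => /eqP I0; rewrite /avg I0 invr0 mulr0.
Qed.

End Average.

(** * Exponential moments of centred bounded variables *)

Lemma expR_le_quadratic {R : realType} (x : R) :
  x <= 1 -> expR x <= 1 + x + x ^+ 2.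
Proof.
(* Since [g' = y (1 - y) exp(-y)], the minimum of [g] below [1] is [g 0 = 1]. *)
move=> x1; pose g : R -> R := (cst 1 + id + id * id) * (expR \o -%R).
have gE y : g y = (1 + y + y * y) * expR (- y) by [].
pose dg (y : R) := y * (1 - y) * expR (- y).
have gd (y : R) : is_derive y 1 g (dg y).
  apply: is_derive_eq.
  change ((1 + y + y * y) * (expR (- y) * -1) +
    expR (- y) * (0 + 1 + (y * 1 + y * 1)) = dg y).
  by rewrite /dg; ring.
have gc (a b : R) : {within `[a, b], continuous g}%classic.
  apply: continuous_subspaceT => y.
  by apply: differentiable_continuous; apply/derivable1_diffP; case: (gd y).
suff : 1 <= g x.
  by rewrite gE expRN ler_pdivlMr ?expR_gt0// mul1r expr2.
have g0 : g 0 = 1 by rewrite gE oppr0 expR0; ring.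
rewrite -g0 -subr_ge0.
have [x0|x0] := leP 0 x.
  have [y yx ->] := MVT_segment x0 (fun y _ => gd y) (gc 0 x).
  move: yx; rewrite in_itv/= => /andP[y0 yx]; rewrite /dg.
  by rewrite !mulr_ge0 ?expR_ge0//; lra.
have [y yx] := MVT_segment (ltW x0) (fun y _ => gd y) (gc x 0).
move: yx; rewrite in_itv/= => /andP[y0 yx].
rewrite -[g x - _]opprB => ->; rewrite /dg -mulNr.
rewrite mulr_ge0 ?oppr_ge0//; last by lra.
by rewrite pmulr_lle0 ?expR_gt0//; nra.
Qed.

(** For [x <= 1] the quadratic bound and [1 + x^2 <= exp(x^2)] suffice; beyond, [x <= x^2]. The
    linear term vanishes once a centred variable is averaged. *)
Lemma expR_le_addr_sqr {R : realType} (x : R) : expR x <= x + expR (x ^+ 2).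
Proof.
have [x1|x1] := leP x 1.
  rewrite (le_trans (expR_le_quadratic x1))//.
  by have := expR_ge1Dx (x ^+ 2); lra.
rewrite ler_wpDl ?ler_expR; [by []|by lra|by nra].
Qed.

(** Hoeffding-type bound, with [l^2 d^2] in place of the sharp [l^2 d^2 / 2]; the loss is affordable
    because the tails start at distance [2 t]. *)
Lemma avg_expR_centered {R : realType} {I : finType} (D : I -> R) (l d : R) :
  avg D = 0 -> (forall i, `|D i| <= d) ->
  avg (fun i => expR (l * D i)) <= expR (l ^+ 2 * d ^+ 2).
Proof.
move=> D0 Dd.
have le1 i : expR (l * D i) <= l * D i + expR (l ^+ 2 * d ^+ 2).
  rewrite (le_trans (expR_le_addr_sqr _))// lerD2l ler_expR exprMn.
  rewrite ler_wpM2l ?sqr_ge0// -real_normK ?num_real//.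
  by rewrite lerXn2r ?nnegrE ?(le_trans _ (Dd i)).
rewrite (le_trans (ler_avg le1))// avgD avgZ D0 mulr0 add0r.
by rewrite avg_le_cst ?expR_ge0.
Qed.

(** * Re-randomising one table entry *)

Lemma hxorC r : commutative (@hxor r).
Proof. by move=> a b; apply/ffunP => j; rewrite !ffunE addbC. Qed.

Lemma hxorK r (v : hval r) : involutive (fun a => hxor a v).
Proof. by move=> a; apply/ffunP => j; rewrite !ffunE addbK. Qed.

Lemma hxor_inj r (v : hval r) : injective (fun a => hxor a v).
Proof. exact: inv_inj (hxorK v). Qed.

Lemma card_hval r : #|{: hval r}| = (2 ^ r)%N.
Proof. by rewrite card_ffun card_bool card_ord. Qed.

Definition tab_xor c sigma r (i : 'I_c) (a : 'I_sigma) (v : hval r)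
    (T : tabfun c sigma r) : tabfun c sigma r :=
  [ffun i' => [ffun a' =>
    if (i' == i) && (a' == a) then hxor (T i' a') v else T i' a']].

Section TabXor.
Context {c sigma r : nat}.
Implicit Types (T : tabfun c sigma r) (x y : key c sigma) (v : hval r).
Implicit Types (i : 'I_c) (a : 'I_sigma).

Lemma tab_xorK i a v : involutive (@tab_xor c sigma r i a v).
Proof.
move=> T; apply/ffunP => i'; apply/ffunP => a'; rewrite !ffunE.
by case: (_ && _); rewrite ?hxorK.
Qed.

Lemma tab_hashE T x (j : 'I_r) :
  tab_hash T x j = \big[addb/false]_(i < c) T i (x i) j.
Proof.
rewrite /tab_hash (@big_morph _ _ (fun u : hval r => u j) false addb)//.
  by move=> u v; rewrite ffunE.
by rewrite ffunE.
Qed.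

Lemma tab_hash_xor i a v T x :
  tab_hash (tab_xor i a v T) x =
  if x i == a then hxor (tab_hash T x) v else tab_hash T x.
Proof.
apply/ffunP => j; rewrite tab_hashE (bigD1 i)//= !ffunE eqxx/=.
rewrite (eq_bigr (fun i' => T i' (x i') j)); last first.
  by move=> i' /negbTE i'i; rewrite !ffunE i'i.
case: ifP => _; rewrite ?ffunE tab_hashE [in RHS](bigD1 i)//=.
by rewrite -!addbA; congr addb; rewrite addbC.
Qed.

Lemma tabfun_gt0 : (0 < #|{: tabfun c sigma r}|)%N.
Proof. by apply/card_gt0P; exists [ffun _ => [ffun _ => hzero r]]. Qed.

Lemma hval_gt0 : (0 < #|{: hval r}|)%N.
Proof. by rewrite card_hval expn_gt0. Qed.

(** Each translation permutes the tables. Averaging over [v] thus plays the role of conditioning on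
    all entries other than [(i, a)]. *)
Lemma avg_tab_xor (R : realType) i a (F : tabfun c sigma r -> R) :
  avg F = avg (fun T => avg (fun v => F (tab_xor i a v T))).
Proof.
rewrite {2}/avg -mulr_suml exchange_big/=.
rewrite (eq_bigr (fun=> \sum_T F T)); last first.
  by move=> v _; rewrite [RHS](reindex_inj (inv_inj (tab_xorK i a v))).
rewrite sumr_const -[_ *+ _]mulr_natr mulfK//.
by rewrite pnatr_eq0 -lt0n hval_gt0.
Qed.

Lemma Pr_tabE (R : realType) (E : pred (tabfun c sigma r)) :
  Pr_tab R E = avg (fun T => (E T)%:R).
Proof.
rewrite /Pr_tab /avg -natr_sum; congr (_%:R / _).
by rewrite -sum1dep_card big_mkcond; apply: eq_bigr => T _; case: (E T).
Qed.

Lemma Pr_tab_le1 (R : realType) (E : pred (tabfun c sigma r)) : Pr_tab R E <= 1.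
Proof. by rewrite Pr_tabE avg_le_cst// => T; rewrite lern1 leq_b1. Qed.

Lemma Pr_tab_markov (R : realType) (E : pred (tabfun c sigma r))
    (F : tabfun c sigma r -> R) :
  (forall T, 0 <= F T) -> (forall T, E T -> 1 <= F T) -> Pr_tab R E <= avg F.
Proof.
by move=> F0 F1; rewrite Pr_tabE ler_avg// => T; case: (boolP (E T)) => // /F1.
Qed.

End TabXor.

(** * The martingale of newly hit bins *)

Lemma card_setUr (I : finType) (A B : {set I}) :
  #|A :|: B| = (#|A :\: B| + #|B|)%N.
Proof.
by rewrite -(cardsID B (A :|: B)) finset.setIC finset.setKU
  finset.setDUl finset.setDv finset.setU0 addnC.
Qed.

Lemma card_imset_setD (I J : finType) (f : I -> J) (A : {set I}) (B : {set J}) :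
  injective f -> #|(f @: A) :\: B| = (\sum_(x in A) (f x \notin B))%N.
Proof.
move=> f_inj.
have -> : (f @: A) :\: B = f @: [set x in A | f x \notin B].
  apply/finset.setP => y.
  apply/finset.setDP/imsetP => [[/imsetP[x xA ->] yB]|[x]].
    by exists x => //; rewrite inE xA.
  by rewrite inE => /andP[xA xB] ->; split=> //; apply: imset_f.
by rewrite card_imset// -sum1dep_card big_mkcondr.
Qed.

Section Groups.
Context {c sigma r : nat}.
Implicit Types (T : tabfun c sigma r) (x : key c sigma) (v : hval r).
Implicit Types (i : 'I_c) (a : 'I_sigma) (A G Y : {set key c sigma}).

Lemma imset_tab_xor_in i a v T A : {in A, forall x, x i = a} ->
  tab_hash (tab_xor i a v T) @: A = [set hxor w v | w in tab_hash T @: A].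
Proof.
move=> Aa; rewrite -imset_comp; apply: eq_in_imset => x xA /=.
by rewrite tab_hash_xor Aa ?eqxx.
Qed.

Lemma imset_tab_xor_out i a v T A : {in A, forall x, x i != a} ->
  tab_hash (tab_xor i a v T) @: A = tab_hash T @: A.
Proof.
move=> Aa; apply: eq_in_imset => x xA.
by rewrite tab_hash_xor (negbTE (Aa _ xA)).
Qed.

Variable R : realType.
Local Notation n := ((2 ^ r)%N%:R : R).

Lemma n_gt0 : 0 < n.
Proof. by rewrite ltr0n expn_gt0. Qed.

Lemma card_hset_le (V : {set hval r}) : #|V|%:R <= n.
Proof. by rewrite ler_nat -card_hval max_card. Qed.

(** For fixed [w] the value [hxor w v] is uniform, so it avoids [V] with probability
    [1 - |V| / n]. *)
Lemma avg_card_xor_setD (V W : {set hval r}) :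
  avg (fun v => #|[set hxor w v | w in W] :\: V|%:R) =
  #|W|%:R * (1 - #|V|%:R / n) :> R.
Proof.
rewrite /avg card_hval -natr_sum.
rewrite (eq_bigr (fun v => \sum_(w in W) (hxor w v \notin V))%N); last first.
  by move=> v _; rewrite card_imset_setD//; exact: hxor_inj.
rewrite exchange_big/=.
rewrite (eq_bigr (fun=> #|~: V|)); last first.
  move=> w _; rewrite -sum1_card [RHS]big_mkcond/=.
  rewrite [RHS](reindex_inj (@hxor_inj r w)); apply: eq_bigr => v _ /=.
  by rewrite inE hxorC; case: (_ \in V).
rewrite sum_nat_const cardsCs finset.setCK card_hval natrM natrB; last first.
  by rewrite -card_hval max_card.
by rewrite -mulrA mulrBl divff// gt_eqF// n_gt0.
Qed.

(** A martingale difference when the keys of [G] share a table entry that [Y] avoids: the subtracted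
    term is then the mean, over that entry, of the number of newly hit bins. *)
Definition fresh G Y T : R :=
  #|tab_hash T @: G :\: tab_hash T @: Y|%:R
  - #|tab_hash T @: G|%:R * (1 - #|tab_hash T @: Y|%:R / n).

Lemma fresh_bound G Y T : `|fresh G Y T| <= #|G|%:R.
Proof.
have /andP[p0 p1] : 0 <= 1 - #|tab_hash T @: Y|%:R / n <= 1.
  rewrite subr_ge0 ler_pdivrMr ?n_gt0// mul1r card_hset_le/=.
  by rewrite gerBl divr_ge0.
have : #|tab_hash T @: G|%:R <= #|G|%:R :> R by rewrite ler_nat leq_imset_card.
have : #|tab_hash T @: G :\: tab_hash T @: Y|%:R <= #|tab_hash T @: G|%:R :> R.
  by rewrite ler_nat subset_leq_card// finset.subsetDl.
have : 0 <= #|tab_hash T @: G :\: tab_hash T @: Y|%:R :> R by [].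
have : 0 <= #|tab_hash T @: G|%:R :> R by [].
rewrite /fresh; move: (1 - _) p0 p1 => p p0 p1.
by rewrite ler_norml; nra.
Qed.

(** One Azuma step: translating the entry [(i, a)] changes neither [F], nor the image of [Y], nor
    the number of values of [G], so given the other entries [fresh] is centred and bounded by
    [|G|]. *)
Lemma avg_expR_layer i a G Y (F : tabfun c sigma r -> R) (l : R) :
  {in G, forall x, x i = a} -> {in Y, forall x, x i != a} ->
  (forall v T, F (tab_xor i a v T) = F T) ->
  avg (fun T => expR (F T) * expR (l * fresh G Y T)) <=
  expR (l ^+ 2 * #|G|%:R ^+ 2) * avg (fun T => expR (F T)).
Proof.
move=> Ga Ya Finv; rewrite (avg_tab_xor i a) -avgZ; apply: ler_avg => T.
under eq_avg do rewrite Finv.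
rewrite avgZ mulrC ler_wpM2r ?expR_ge0//.
apply: avg_expR_centered => [|v]; last exact: fresh_bound.
rewrite /fresh.
under eq_avg do rewrite imset_tab_xor_in// imset_tab_xor_out//
  (card_imset _ (@hxor_inj r _)).
by rewrite avgD avg_card_xor_setD avg_cst ?hval_gt0// subrr.
Qed.

(* A group carries the position character shared by its keys; in a layered
   list the keys of the tail avoid the character of the head, so that this
   table entry is still fresh once the tail has been hashed. *)
Definition group : Type := ('I_c * 'I_sigma * {set key c sigma})%type.
Implicit Types (g : group) (gs : seq group).

Definition covered gs : {set key c sigma} := \bigcup_(g <- gs) g.2.

Fixpoint layered gs : Prop :=
  if gs is g :: gs' then
    [/\ {in g.2, forall x, x g.1.1 = g.1.2},
        {in covered gs', forall x, x g.1.1 != g.1.2} & layered gs']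
  else True.

(** Empty bins, unlike hit ones, have a multiplicative mean recursion: a group with [d] values keeps
    a fraction [1 - d / n] of them. *)
Definition empty_bins gs T : R := n - #|tab_hash T @: covered gs|%:R.

Definition excess gs T : R :=
  \sum_(g <- gs) (#|g.2|%:R - #|tab_hash T @: g.2|%:R).

(** In a layered list, the expected fraction of empty bins if every group were hashed
    injectively. *)
Definition survival gs : R := \prod_(g <- gs) (1 - #|g.2|%:R / n).

Definition sumsq gs : R := \sum_(g <- gs) #|g.2|%:R ^+ 2.

Lemma covered_cons g gs : covered (g :: gs) = g.2 :|: covered gs.
Proof. by rewrite /covered big_cons. Qed.

Lemma mem_covered g gs : g \in gs -> g.2 \subset covered gs.
Proof.
elim: gs => // h gs IH; rewrite inE covered_cons => /predU1P[->|/IH gA].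
  exact: finset.subsetUl.
exact: fintype.subset_trans gA (finset.subsetUr _ _).
Qed.

Lemma excess_ge0 gs T : 0 <= excess gs T.
Proof. by apply: sumr_ge0 => g _; rewrite subr_ge0 ler_nat leq_imset_card. Qed.

Lemma empty_bins_cons g gs T :
  empty_bins (g :: gs) T =
  empty_bins gs T - #|tab_hash T @: g.2 :\: tab_hash T @: covered gs|%:R.
Proof.
rewrite /empty_bins covered_cons imsetU card_setUr natrD; ring.
Qed.

Lemma empty_bins_tab_xor i a v gs T : {in covered gs, forall x, x i != a} ->
  empty_bins gs (tab_xor i a v T) = empty_bins gs T.
Proof. by move=> gsa; rewrite /empty_bins imset_tab_xor_out. Qed.

Lemma excess_tab_xor i a v gs T : {in covered gs, forall x, x i != a} ->
  excess gs (tab_xor i a v T) = excess gs T.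
Proof.
move=> gsa; rewrite /excess !big_seq; apply: eq_bigr => g ggs.
rewrite imset_tab_xor_out// => x xg; apply: gsa.
exact: (fintype.subsetP (mem_covered ggs)).
Qed.

Lemma empty_binsE gs T :
  1 - #|tab_hash T @: covered gs|%:R / n = empty_bins gs T / n.
Proof. by rewrite /empty_bins mulrBl divff// gt_eqF// n_gt0. Qed.

Lemma survival_factor g gs :
  all (fun g : group => #|g.2| <= 2 ^ r)%N (g :: gs) ->
  [/\ 0 <= 1 - #|g.2|%:R / n, 1 - #|g.2|%:R / n <= 1 &
      all (fun g : group => #|g.2| <= 2 ^ r)%N gs].
Proof.
move=> /andP[gn gsn]; split; [|by rewrite gerBl divr_ge0|exact: gsn].
by rewrite subr_ge0 ler_pdivrMr ?n_gt0// mul1r ler_nat.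
Qed.

Lemma sumsq_step g gs (l a : R) : 0 <= a <= 1 ->
  expR (l ^+ 2 * #|g.2|%:R ^+ 2) * expR ((l * a) ^+ 2 * sumsq gs) <=
  expR (l ^+ 2 * sumsq (g :: gs)).
Proof.
move=> /andP[a0 a1]; rewrite -expRD ler_expR /sumsq big_cons mulrDr lerD2l.
rewrite exprMn -mulrA ler_wpM2l ?sqr_ge0// ler_piMl//.
  by apply: sumr_ge0 => h _; rewrite sqr_ge0.
by rewrite expr_le1.
Qed.

(** If the head group has [k] keys and [d] values, and [Z] bins were empty, the mean loss [d Z / n]
    is at most [k Z / n]. So the new deviation is at most [1 - k / n] times the old one plus
    [fresh]; collisions inside the group only help. *)
Lemma avg_expR_survivalB_empty gs (l : R) :
  layered gs -> all (fun g : group => #|g.2| <= 2 ^ r)%N gs -> 0 <= l ->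
  avg (fun T => expR (l * (n * survival gs - empty_bins gs T))) <=
  expR (l ^+ 2 * sumsq gs).
Proof.
elim: gs l => [|g gs IH] l.
  move=> _ _ _; apply: avg_le_cst => [|T]; first exact: expR_ge0.
  rewrite /survival /empty_bins /sumsq /covered !big_nil imset0 cards0.
  by rewrite ler_expR; lra.
move=> [gin gout lay] /survival_factor[a0 a1 gsn] l0.
have a01 : 0 <= 1 - #|g.2|%:R / n <= 1 by rewrite a0.
apply: le_trans (sumsq_step g gs l a01).
apply: le_trans (ler_wpM2l (expR_ge0 _) (IH _ lay gsn _)); last first.
  by rewrite mulr_ge0.
apply: le_trans (avg_expR_layer _ gin gout _); last first.
  by move=> v T; rewrite empty_bins_tab_xor.
apply: ler_avg => T; rewrite -expRD ler_expR -mulrA -mulrDr ler_wpM2l//.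
rewrite empty_bins_cons /survival big_cons /fresh empty_binsE.
have : 0 <= empty_bins gs T / n.
  by rewrite divr_ge0 ?(ltW n_gt0)// subr_ge0 card_hset_le.
have : #|tab_hash T @: g.2|%:R <= #|g.2|%:R :> R.
  by rewrite ler_nat leq_imset_card.
move: (\prod_(_ <- _) _) => P.
set k : R := #|g.2|%:R; set d : R := #|tab_hash T @: g.2|%:R.
have -> : (1 - k / n) * (n * P - empty_bins gs T) =
  n * ((1 - k / n) * P) - empty_bins gs T + k * (empty_bins gs T / n) by ring.
by nra.
Qed.

(** Here a group with [d < k] values leaves on average up to [k - d] more empty bins than the
    product predicts; subtracting [excess] compensates. *)
Lemma avg_expR_emptyB_survival gs (l : R) :
  layered gs -> all (fun g : group => #|g.2| <= 2 ^ r)%N gs -> 0 <= l ->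
  avg (fun T => expR (l * (empty_bins gs T - n * survival gs - excess gs T))) <=
  expR (l ^+ 2 * sumsq gs).
Proof.
elim: gs l => [|g gs IH] l.
  move=> _ _ _; apply: avg_le_cst => [|T]; first exact: expR_ge0.
  rewrite /survival /empty_bins /sumsq /excess /covered !big_nil imset0 cards0.
  by rewrite ler_expR; lra.
move=> [gin gout lay] /survival_factor[a0 a1 gsn] l0.
have a01 : 0 <= 1 - #|g.2|%:R / n <= 1 by rewrite a0.
apply: le_trans (sumsq_step g gs l a01).
apply: le_trans (ler_wpM2l (expR_ge0 _) (IH _ lay gsn _)); last first.
  by rewrite mulr_ge0.
(* [fresh] now enters with a minus sign, so the one-group bound is used at [- l]. *)
rewrite -[l in expR (l ^+ 2 * _ ^+ 2)]opprK sqrrN.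
apply: le_trans (avg_expR_layer _ gin gout _); last first.
  by move=> v T; rewrite empty_bins_tab_xor// excess_tab_xor.
apply: ler_avg => T; rewrite -expRD ler_expR mulNr -mulrA -mulrBr ler_wpM2l//.
rewrite empty_bins_cons /survival /excess !big_cons /fresh empty_binsE.
have Z1 : empty_bins gs T / n <= 1.
  by rewrite ler_pdivrMr ?n_gt0// mul1r gerBl.
have : #|tab_hash T @: g.2|%:R <= #|g.2|%:R :> R.
  by rewrite ler_nat leq_imset_card.
have := excess_ge0 gs T; rewrite /excess; move: (\sum_(_ <- _) _) => C C0.
move: (\prod_(_ <- _) _) => P.
(* The scaled induction hypothesis subtracts only part of [C]; this remainder has the favourable
   sign. *)
have : 0 <= #|g.2|%:R / n * C by rewrite mulr_ge0// divr_ge0.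
set k : R := #|g.2|%:R; set d : R := #|tab_hash T @: g.2|%:R.
have -> : (1 - k / n) * (empty_bins gs T - n * P - C) =
  empty_bins gs T - n * ((1 - k / n) * P) - k * (empty_bins gs T / n)
  - C + k / n * C by ring.
by nra.
Qed.

End Groups.

Arguments survival {c sigma} r R gs.

(** * Layering a key set by small groups *)

(* Pigeonhole: X lies in the product of its projections A_i, and the lightest
   fibre over A_i has at most |X| / |A_i| keys. *)
Lemma small_fiber c sigma (X : {set key c sigma}) :
  (0 < c)%N -> X != finset.set0 ->
  exists i a, (0 < #|[set x in X | x i == a]|)%N /\
    (#|[set x in X | x i == a]| ^ c <= #|X| ^ c.-1)%N.
Proof.
move=> c0 /set0Pn[x0 x0X].
pose A i := [set (x : key c sigma) i | x in X].
pose fib i a := [set x in X | x i == a].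
have x0A i : x0 i \in A i by apply/imsetP; exists x0.
pose a i := [arg min_(b < x0 i in A i) #|fib i b|].
have aA i : a i \in A i by rewrite /a; case: arg_minnP.
have amin i b : b \in A i -> (#|fib i (a i)| <= #|fib i b|)%N.
  by rewrite /a; case: arg_minnP => // b' _; exact.
have Xprod : (#|X| <= \prod_i #|A i|)%N.
  have <- : #|family (fun i => mem (A i))| = (\prod_i #|A i|)%N.
    by rewrite card_family foldrE big_map big_enum.
  apply/subset_leq_card/fintype.subsetP => x xX; apply/familyP => i.
  by apply/imsetP; exists x.
have fibX i : (#|fib i (a i)| * #|A i| <= #|X|)%N.
  rewrite -[leqRHS]sum1_card (partition_big_imset (fun x : key c sigma => x i))/=.
  rewrite mulnC -sum_nat_const leq_sum// => b bA.
  by rewrite (leq_trans (amin i b bA))// -sum1dep_card.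
pose i := [arg min_(j < Ordinal c0) #|fib j (a j)|].
have imin j : (#|fib i (a i)| <= #|fib j (a j)|)%N.
  by rewrite /i; case: arg_minnP => // j' _; exact.
have X0 : (0 < #|X|)%N by apply/card_gt0P; exists x0.
exists i, (a i); split.
  have /imsetP[x xX ax] := aA i.
  by apply/card_gt0P; exists x; rewrite inE xX ax eqxx.
(* After multiplying by [|X|], itself at most the product of the projection sizes, each position
   contributes a factor [|fib| * |A| <= |X|]. *)
rewrite -(leq_pmul2r X0) -expnSr prednK//.
apply: (@leq_trans (\prod_j #|fib j (a j)| * \prod_j #|A j|)).
  rewrite leq_mul// -[X in (_ ^ X)%N]card_ord -prod_nat_const.
  by apply: leq_prod => j _; exact: imin.
rewrite -big_split/= -[X in (_ ^ X)%N]card_ord -prod_nat_const.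
by apply: leq_prod => j _; exact: fibX.
Qed.

(** Peel off a small fibre and recurse on the rest, which avoids the peeled character; the size
    bound only shrinks with the set. *)
Lemma exists_layering c sigma (X : {set key c sigma}) : (0 < c)%N ->
  exists gs : seq (@group c sigma),
  [/\ layered gs, covered gs = X, (\sum_(g <- gs) #|g.2|)%N = #|X| &
      all (fun g : group => #|g.2| ^ c <= #|X| ^ c.-1)%N gs].
Proof.
move=> c0; have [N] := ubnP #|X|; elim: N X => // N IH X XN.
have [->|X0] := eqVneq X finset.set0.
  by exists [::]; split=> //; rewrite /covered ?big_nil ?cards0.
have [i [a [G0 Gle]]] := small_fiber c0 X0.
set G := [set x in X | x i == a] in G0 Gle.
have GX : G \subset X by apply/fintype.subsetP => x; rewrite inE => /andP[].
have XG : (#|X :\: G| + #|G| = #|X|)%N.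
  by rewrite cardsDS// subnK// subset_leq_card.
have [|gs [lay cov sz small]] := IH (X :\: G).
  by rewrite -XG in XN; rewrite -ltnS (leq_trans _ XN)// ltnS -addn1 leq_add2l.
exists ((i, a, G) :: gs); split.
- split=> // x /=; first by rewrite inE => /andP[_ /eqP].
  by rewrite cov !inE => /andP[+ xX]; rewrite xX.
- rewrite covered_cons cov /= finset.setDE finset.setUIr finset.setUCr finset.setIT.
  exact/finset.setUidPr.
- by rewrite big_cons sz addnC.
- rewrite /= Gle/=; apply: sub_all small => g /leq_trans; apply.
  case: (c.-1) => // k.
  by rewrite leq_exp2r// subset_leq_card// finset.subsetDl.
Qed.

(** * Additive quadruples *)

(** The table entries on which a collision of the pair depends: an entry used by both keys cancels
    in the XOR. *)
Definition sym_diff c sigma (p : key c sigma * key c sigma) :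
    {set 'I_c * 'I_sigma} :=
  [set e | (p.1 e.1 == e.2) (+) (p.2 e.1 == e.2)].

(** At position [i] the four characters cancel in pairs, and there are three ways to pair them. *)
Lemma sym_diff_matching c sigma (x y z w : key c sigma) (i : 'I_c) :
  sym_diff (x, y) = sym_diff (z, w) ->
  [|| (x i == y i) && (z i == w i), (x i == z i) && (y i == w i) |
      (x i == w i) && (y i == z i)].
Proof.
move=> /setP e; have := e (i, x i); have := e (i, y i); have := e (i, z i).
rewrite !inE/= !eqxx; have [<-|xy] := eqVneq (x i) (y i).
  by rewrite addbb eq_sym => /esym/negbT; rewrite /= negbK eq_sym => ->.
move=> _; have [zx|zx] := eqVneq (z i) (x i).
  by rewrite zx (negbTE xy) /= [w i == y i]eq_sym => <-.
by rewrite /= => + /esym/eqP wx; rewrite wx eqxx (negbTE xy) addbF eq_sym.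
Qed.

Lemma card_join (I J K : finType) (P : {set I}) (Q : {set J})
    (f : I -> K) (g : J -> K) :
  #|[set pq | [&& pq.1 \in P, pq.2 \in Q & f pq.1 == g pq.2]]| =
  (\sum_k #|[set p in P | f p == k]| * #|[set q in Q | g q == k]|)%N.
Proof.
rewrite -sum1dep_card (partition_big (fun pq => f pq.1) xpredT)//=.
apply: eq_bigr => k _; rewrite -cardsX -sum1_card; apply: eq_bigl => -[p q].
rewrite !inE/=; case: (p \in P) => //=; case: (q \in Q) => //=; rewrite ?andbF//.
by have [->|] := eqVneq (f p) k; rewrite ?andbF// andbT eq_sym.
Qed.

(** Fibrewise this is [2 a b <= a^2 + b^2]. *)
Lemma card_join_le (I J K : finType) (P : {set I}) (Q : {set J})
    (f : I -> K) (g : J -> K) :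
  (2 * #|[set pq | [&& pq.1 \in P, pq.2 \in Q & f pq.1 == g pq.2]]| <=
   #|[set pq | [&& pq.1 \in P, pq.2 \in P & f pq.1 == f pq.2]]| +
   #|[set pq | [&& pq.1 \in Q, pq.2 \in Q & g pq.1 == g pq.2]]|)%N.
Proof.
rewrite !card_join big_distrr -big_split/=; apply: leq_sum => k _.
by rewrite !mulnn nat_Cauchy.
Qed.

Lemma card_bigcup_le (I J : finType) (A : I -> {set J}) :
  (#|\bigcup_i A i| <= \sum_i #|A i|)%N.
Proof.
elim/big_rec2: _ => [|i k B _ kB]; first by rewrite cards0.
by rewrite (leq_trans (leq_card_setU _ _))// leq_add2l.
Qed.

Section Quadruples.
Context {c sigma : nat} (X : {set key c sigma}).

(** For joined pairs [(x, w)] and [(x', w')], [x = x'] and [w = w'] off [C], while [x = w] and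
    [x' = w'] on [C]. Hence [x] and [w'] determine the other two. *)
Lemma card_self_join (K : finType) (C : pred 'I_c)
    (P : {set key c sigma * key c sigma}) (f : key c sigma * key c sigma -> K) :
  {in P, forall p, [/\ p.1 \in X, p.2 \in X & forall i, C i -> p.1 i = p.2 i]} ->
  (forall p q, f p = f q ->
     forall i, ~~ C i -> p.1 i = q.1 i /\ p.2 i = q.2 i) ->
  (#|[set pq | [&& pq.1 \in P, pq.2 \in P & f pq.1 == f pq.2]]| <= #|X| ^ 2)%N.
Proof.
move=> PX finj; rewrite -mulnn -cardsX.
set A := [set pq | _].
rewrite -(card_in_imset (f := fun pq => (pq.1.1, pq.2.2)) (D := mem A)).
  apply/subset_leq_card/fintype.subsetP => _ /imsetP[pq + ->].
  by rewrite !inE => /and3P[/PX[-> _ _] /PX[_ -> _] _].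
move=> [[x w] [x' w']] [[y z] [y' z']]; rewrite !inE/=.
move=> /and3P[/PX[_ _ /= xw] /PX[_ _ /= xw'] /eqP f1].
move=> /and3P[/PX[_ _ /= yz] /PX[_ _ /= yz'] /eqP f2].
move=> [ex ew]; subst y z'.
suff [-> ->] : x' = y' /\ w = z by [].
split; apply/ffunP => i; have [Ci|Ci] := boolP (C i).
- by rewrite xw'// yz'.
- by have [/= <- _] := finj _ _ f1 i Ci; have [/= <- _] := finj _ _ f2 i Ci.
- by rewrite -xw// -yz.
- by have [/= _ ->] := finj _ _ f1 i Ci; have [/= _ ->] := finj _ _ f2 i Ci.
Qed.

Definition matched (m : 'I_3) (x y z w : 'I_sigma) : bool :=
  if m == 0%N :> nat then (x == y) && (z == w)
  else if m == 1%N :> nat then (x == z) && (y == w)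
  else (x == w) && (y == z).

Definition matched_quadruples (m : {ffun 'I_c -> 'I_3}) :
    {set (key c sigma * key c sigma) * (key c sigma * key c sigma)} :=
  [set q | [&& q.1.1 \in X, q.1.2 \in X, q.2.1 \in X, q.2.2 \in X &
     [forall i, matched (m i) (q.1.1 i) (q.1.2 i) (q.2.1 i) (q.2.2 i)]]].

(* Grouping a quadruple (x, y, z, w) as (x, w) and (y, z), which share the
   coordinates outside C, Cauchy-Schwarz reduces the count to quadruples
   determined by two of their keys. *)
Lemma card_matched_quadruples m : (#|matched_quadruples m| <= #|X| ^ 2)%N.
Proof.
pose C i := (1 < m i)%N.
pose P := [set p : key c sigma * key c sigma |
    [&& p.1 \in X, p.2 \in X & [forall i, C i ==> (p.1 i == p.2 i)]]].
pose f (p : key c sigma * key c sigma) :=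
  [ffun i => if C i then None else Some (p.1 i, p.2 i)].
(* Applied to [(y, z)], the swap mirrors the pairing with [(x, w)]: [x = y], [w = z] if [m i = 0],
   and [x = z], [w = y] if [m i = 1]. *)
pose g (p : key c sigma * key c sigma) :=
  [ffun i => if C i then None else
     if m i == 0%N :> nat then Some (p.1 i, p.2 i) else Some (p.2 i, p.1 i)].
set A := matched_quadruples m.
have := card_join_le P P f g.
have PX : {in P, forall p,
    [/\ p.1 \in X, p.2 \in X & forall i, C i -> p.1 i = p.2 i]}.
  move=> p; rewrite inE => /and3P[pX qX /forallP pq]; split=> // i Ci.
  by apply/eqP; move: (pq i); rewrite Ci.
set J := [set pq | [&& pq.1 \in P, pq.2 \in P & f pq.1 == g pq.2]].
move=> Jle; suff AJ : (#|A| <= #|J|)%N.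
  rewrite -(leq_pmul2l (isT : 0 < 2)%N) (leq_trans _ (leq_trans Jle _))//.
    by rewrite leq_mul2l.
  rewrite mul2n -addnn leq_add//.
    apply: (card_self_join PX) => p q /ffunP e i /negbTE Ci.
    by have := e i; rewrite !ffunE Ci => -[].
  apply: (card_self_join PX) => p q /ffunP e i /negbTE Ci.
  by have := e i; rewrite !ffunE Ci; case: ifP => _ [].
pose h (q : (key c sigma * key c sigma) * (key c sigma * key c sigma)) :=
  ((q.1.1, q.2.2), (q.1.2, q.2.1)).
have h_inj : injective h.
  by move=> [[x y] [z w]] [[x' y'] [z' w']] [-> -> -> ->].
rewrite -(card_imset (mem A) h_inj); apply/subset_leq_card/fintype.subsetP.
move=> _ /imsetP[[[x y] [z w]] + ->]; rewrite !inE/=.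
move=> /and5P[-> -> -> -> /forallP M]; apply/and3P; split.
- apply/forallP => i; apply/implyP; have := M i; rewrite /matched /C.
  by case: (m i) => [[|[|k]] ?]//= /andP[].
- apply/forallP => i; apply/implyP; have := M i; rewrite /matched /C.
  by case: (m i) => [[|[|k]] ?]//= /andP[].
- apply/eqP/ffunP => i; rewrite !ffunE; have := M i; rewrite /matched /C.
  by case: (m i) => [[|[|k]] ?]//= /andP[/eqP -> /eqP ->].
Qed.

(** Choosing one pairing per position gives [3^c] classes that cover all these quadruples. *)
Lemma card_additive_quadruples (P : {set key c sigma * key c sigma}) :
  (forall p, p \in P -> (p.1 \in X) && (p.2 \in X)) ->
  (#|[set q | [&& q.1 \in P, q.2 \in P & sym_diff q.1 == sym_diff q.2]]|
   <= 3 ^ c * #|X| ^ 2)%N.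
Proof.
move=> PX.
have -> : (3 ^ c * #|X| ^ 2 = \sum_(m : {ffun 'I_c -> 'I_3}) #|X| ^ 2)%N.
  by rewrite sum_nat_const card_ffun !card_ord.
apply: (@leq_trans (\sum_m #|matched_quadruples m|)); last first.
  by apply: leq_sum => m _; exact: card_matched_quadruples.
apply: leq_trans (card_bigcup_le _).
apply/subset_leq_card/fintype.subsetP => -[[x y] [z w]].
rewrite inE/= => /and3P[/PX/= /andP[xX yX] /PX/= /andP[zX wX] /eqP e].
pose m : {ffun 'I_c -> 'I_3} := [ffun i =>
  if (x i == y i) && (z i == w i) then inord 0
  else if (x i == z i) && (y i == w i) then inord 1 else inord 2].
apply/bigcupP; exists m => //; rewrite inE/= xX yX zX wX/=.
apply/forallP => i; have := sym_diff_matching i e; rewrite /matched ffunE.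
case: ((x i == y i) && (z i == w i)) => [_|]; first by rewrite inordK.
case: ((x i == z i) && (y i == w i)) => [_|/= ->]; first by rewrite inordK.
by rewrite !inordK.
Qed.

End Quadruples.

(** * Variance of the number of collisions *)

(** Keep one representative per value: every other key collides with its representative, and
    distinct keys give distinct pairs. *)
Lemma card_le_imset_collisions (I J : finType) (f : I -> J) (G : {set I}) :
  (#|G| <= #|f @: G| +
   #|[set p | [&& p.1 \in G, p.2 \in G, p.1 != p.2 & f p.1 == f p.2]]|)%N.
Proof.
have [->|[x0 x0G]] := set_0Vmem G; first by rewrite cards0.
pose rep y := odflt x0 [pick x in G | f x == y].
have repP x : x \in G -> rep (f x) \in G /\ f (rep (f x)) = f x.
  move=> xG; rewrite /rep; case: pickP => [y /andP[yG /eqP]//|/(_ x)].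
  by rewrite xG eqxx.
pose N := [set x in G | rep (f x) != x].
have GN : G \subset rep @: (f @: G) :|: N.
  apply/fintype.subsetP => x xG; rewrite inE [x \in N]inE xG/=.
  have [e|] := eqVneq (rep (f x)) x; last by rewrite orbT.
  by rewrite orbF -e; apply: imset_f; apply: imset_f.
rewrite (leq_trans (subset_leq_card GN))//.
rewrite (leq_trans (leq_card_setU _ _))// leq_add ?leq_imset_card//.
have g_inj : injective (fun x => (rep (f x), x)) by move=> x y [].
rewrite -(card_imset (mem N) g_inj); apply/subset_leq_card/fintype.subsetP.
move=> _ /imsetP[x + ->]; rewrite !inE => /andP[xG ->].
by have [-> ->] := repP x xG; rewrite xG eqxx.
Qed.

Lemma hxor_eq r (a b v : hval r) : (hxor a v == b) = (v == hxor a b).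
Proof.
by apply/eqP/eqP => [<-|->]; apply/ffunP => j; rewrite !ffunE addKb.
Qed.

Section Collisions.
Context {c sigma r : nat} {R : realType}.
Implicit Types (T : tabfun c sigma r) (p q : key c sigma * key c sigma).
Local Notation n := ((2 ^ r)%N%:R : R).

Definition collide p T : bool := tab_hash T p.1 == tab_hash T p.2.

Definition coll_dev p T : R := (collide p T)%:R - n^-1.

Lemma collide_tab_xor_out i a v p T : (i, a) \notin sym_diff p ->
  collide p (tab_xor i a v T) = collide p T.
Proof.
rewrite inE/= /collide !tab_hash_xor.
case: (p.1 i == a); case: (p.2 i == a) => //= _.
exact: (inj_eq (@hxor_inj r v)).
Qed.

Lemma collide_tab_xor_in i a v p T : (i, a) \in sym_diff p ->
  collide p (tab_xor i a v T) = (v == hxor (tab_hash T p.1) (tab_hash T p.2)).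
Proof.
rewrite inE/= /collide !tab_hash_xor.
case: (p.1 i == a); case: (p.2 i == a) => //= _.
  exact: hxor_eq.
by rewrite eq_sym hxor_eq hxorC.
Qed.

Lemma avg_collide_xor i a p T : (i, a) \in sym_diff p ->
  avg (fun v => (collide p (tab_xor i a v T))%:R) = n^-1 :> R.
Proof.
move=> e; under eq_avg do rewrite (collide_tab_xor_in _ _ e).
rewrite /avg card_hval (bigD1 (hxor (tab_hash T p.1) (tab_hash T p.2)))//=.
by rewrite eqxx big1 ?addr0 ?mul1r// => v /negbTE ->.
Qed.

Lemma avg_coll_dev_xor i a p T : (i, a) \in sym_diff p ->
  avg (fun v => coll_dev p (tab_xor i a v T)) = 0.
Proof.
by move=> e; rewrite avgD avg_collide_xor// avg_cst ?hval_gt0// subrr.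
Qed.

(** Randomising [e] alone leaves the collision of [q] unchanged and averages the deviation of [p] to
    zero. *)
Lemma avg_coll_dev_mul0 e p q : e \in sym_diff p -> e \notin sym_diff q ->
  avg (fun T => coll_dev p T * coll_dev q T) = 0.
Proof.
case: e => i a ep eq; rewrite (avg_tab_xor i a).
rewrite -[RHS](avg_cst 0 (@tabfun_gt0 c sigma r)).
apply: eq_avg => T; under eq_avg do
  rewrite {2}/coll_dev collide_tab_xor_out// -/(coll_dev q T) mulrC.
by rewrite avgZ avg_coll_dev_xor ?mulr0.
Qed.

Lemma avg_coll_dev_indep p q : sym_diff p != sym_diff q ->
  avg (fun T => coll_dev p T * coll_dev q T) = 0.
Proof.
move=> pq; have [e] : exists e, (e \in sym_diff p) != (e \in sym_diff q).
  apply/existsP; apply: contraNT pq => /existsPn e; apply/eqP/setP => x.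
  by apply/eqP; rewrite -[_ == _]negbK e.
case ep : (e \in sym_diff p); case eq : (e \in sym_diff q) => // _.
  by rewrite (@avg_coll_dev_mul0 e)// eq.
under eq_avg do rewrite mulrC.
by rewrite (@avg_coll_dev_mul0 e)// ep.
Qed.

Lemma avg_coll_dev_sqr p : p.1 != p.2 ->
  avg (fun T => coll_dev p T ^+ 2) <= n^-1.
Proof.
move=> p12; have [i pi] : exists i, p.1 i != p.2 i.
  apply/existsP; apply: contraNT p12 => /existsPn e; apply/eqP/ffunP => x.
  by apply/eqP; rewrite -[_ == _]negbK e.
have e : (i, p.1 i) \in sym_diff p by rewrite inE/= eqxx eq_sym (negbTE pi).
have n0 : 0 < n^-1 by rewrite invr_gt0 n_gt0.
rewrite (avg_tab_xor i (p.1 i)); apply: avg_le_cst => [|T]; first exact: ltW.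
rewrite (@eq_avg _ _ _ (fun v => (1 - 2 * n^-1) *
  (collide p (tab_xor i (p.1 i) v T))%:R + n^-1 ^+ 2)); last first.
  by move=> v; rewrite /coll_dev; case: collide; rewrite /=; ring.
rewrite avgD avgZ avg_collide_xor// avg_cst ?hval_gt0//; nra.
Qed.

Lemma avg_coll_dev_le p q : p.1 != p.2 -> q.1 != q.2 ->
  avg (fun T => coll_dev p T * coll_dev q T) <= n^-1.
Proof.
move=> p12 q12.
have pq T : coll_dev p T * coll_dev q T <=
    2^-1 * coll_dev p T ^+ 2 + 2^-1 * coll_dev q T ^+ 2.
  by have := sqr_ge0 (coll_dev p T - coll_dev q T); nra.
rewrite (le_trans (ler_avg pq))// avgD !avgZ.
by have := avg_coll_dev_sqr p12; have := avg_coll_dev_sqr q12; lra.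
Qed.

(** Only pairs with equal [sym_diff] can be correlated; each such term is at most [1 / n], and their
    number is the count of additive quadruples. *)
Lemma collision_variance (X : {set key c sigma})
    (P : {set key c sigma * key c sigma}) :
  (forall p, p \in P -> [&& p.1 \in X, p.2 \in X & p.1 != p.2]) ->
  avg (fun T => (\sum_(p in P) coll_dev p T) ^+ 2) <=
  3 ^+ c * #|X|%:R ^+ 2 / n.
Proof.
move=> PX.
rewrite (@eq_avg _ _ _ (fun T => \sum_(p in P) \sum_(q in P)
    coll_dev p T * coll_dev q T)); last first.
  by move=> T; rewrite expr2 mulr_suml; apply: eq_bigr => p _; rewrite mulr_sumr.
rewrite avg_sum; under eq_bigr do rewrite avg_sum.
rewrite pair_big/=.
rewrite (le_trans (y := \sum_(pq | (pq.1 \in P) && (pq.2 \in P))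
    (if sym_diff pq.1 == sym_diff pq.2 then n^-1 else 0)))//.
  apply: ler_sum => -[p q] /= /andP[/PX/and3P[_ _ p12] /PX/and3P[_ _ q12]].
  by case: eqVneq => [_|/avg_coll_dev_indep ->]; [exact: avg_coll_dev_le|].
rewrite -big_mkcondr/= sumr_const -[_ *+ _]mulr_natl.
rewrite ler_wpM2r ?invr_ge0// -natrX -natrX -natrM ler_nat.
apply: leq_trans (card_additive_quadruples (X := X) (P := P) _).
  rewrite -[leqRHS]sum1_card -sum1_card; apply/eq_leq/eq_bigl => pq.
  by rewrite [RHS]inE [LHS]unfold_in/= andbA.
by move=> p /PX/and3P[-> ->].
Qed.

(** Pairs are ordered, so a collision counts twice; their number still stays below [sumsq]. *)
Definition group_pairs (gs : seq (@group c sigma)) :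
    {set key c sigma * key c sigma} :=
  \bigcup_(g <- gs) [set p | [&& p.1 \in g.2, p.2 \in g.2 & p.1 != p.2]].

Lemma mem_group_pairs gs p : p \in group_pairs gs ->
  [&& p.1 \in covered gs, p.2 \in covered gs & p.1 != p.2].
Proof.
elim: gs => [|g gs IH]; rewrite /group_pairs ?big_nil ?inE// big_cons covered_cons.
rewrite !inE => /orP[/and3P[-> -> ->]//|/IH/and3P[-> -> ->]].
by rewrite !orbT.
Qed.

Lemma group_pairs_cons g gs (F : key c sigma * key c sigma -> R) :
  layered (g :: gs) ->
  \sum_(p in group_pairs (g :: gs)) F p =
  \sum_(p in [set p | [&& p.1 \in g.2, p.2 \in g.2 & p.1 != p.2]]) F p +
  \sum_(p in group_pairs gs) F p.
Proof.
move=> [gin gout _]; rewrite {1}/group_pairs big_cons -bigU/=.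
  by apply: eq_bigl => p; rewrite !inE.
rewrite disjoint_subset; apply/fintype.subsetP => p; rewrite !inE.
move=> /and3P[/gin/eqP pg _ _]; apply/negP => /mem_group_pairs/and3P[/gout].
by rewrite pg.
Qed.

Lemma card_group_pairs gs : layered gs ->
  #|group_pairs gs|%:R <= sumsq R gs.
Proof.
elim: gs => [|g gs IH] lay.
  by rewrite /group_pairs /sumsq !big_nil cards0.
have [_ _ /IH {}IH] := lay.
rewrite /sumsq big_cons -sum1_card natr_sum (group_pairs_cons _ lay).
rewrite lerD//; last by rewrite -natr_sum sum1_card.
rewrite -natr_sum sum1_card -natrX ler_nat -mulnn -cardsX subset_leq_card//.
by apply/fintype.subsetP => p; rewrite !inE => /and3P[-> ->].
Qed.

Lemma excess_le_collisions gs T : layered gs ->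
  excess R gs T <= \sum_(p in group_pairs gs) (collide p T)%:R.
Proof.
elim: gs => [|g gs IH] lay.
  by rewrite /group_pairs /excess !big_nil big_set0.
have [_ _ /IH {}IH] := lay.
rewrite /excess big_cons (group_pairs_cons _ lay) lerD// lerBlDl.
rewrite -natr_sum -natrD ler_nat.
rewrite (leq_trans (card_le_imset_collisions (tab_hash T) g.2))// leq_add2l.
rewrite -sum1dep_card big_mkcond [leqRHS]big_mkcond/= leq_sum// => p _.
rewrite inE /collide.
by case: (_ \in _); case: (_ \in _); case: (_ != _); case: (_ == _).
Qed.

End Collisions.

(** * Tail bounds *)

Lemma bernoulli_ge {R : realType} (x : R) k : 0 <= x <= 1 ->
  1 - k%:R * x <= (1 - x) ^+ k.
Proof.
move=> /andP[x0 x1]; elim: k => [|k IH]; first by rewrite mul0r subr0 expr0.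
rewrite exprS -natr1; have : 0 <= k%:R :> R by [].
by move: (_ ^+ k) (k%:R) IH => y z; nra.
Qed.

Lemma bernoulli_le {R : realType} (x : R) k : 0 <= x <= 1 ->
  (1 - x) ^+ k <= 1 - k%:R * x + (k%:R * x) ^+ 2.
Proof.
move=> /andP[x0 x1]; elim: k => [|k IH].
  by rewrite mul0r subr0 expr0 expr0n addr0.
rewrite exprS -natr1; have z0 : 0 <= k%:R :> R by [].
apply: le_trans (ler_wpM2l _ IH) _; first by rewrite subr_ge0.
move: (k%:R) z0 => z z0; rewrite -subr_ge0.
have -> : 1 - (z + 1) * x + ((z + 1) * x) ^+ 2 -
    (1 - x) * (1 - z * x + (z * x) ^+ 2) =
  z * x ^+ 2 + x ^+ 2 + z ^+ 2 * x ^+ 3 by ring.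
by rewrite !addr_ge0// ?mulr_ge0 ?exprn_ge0.
Qed.

Section Tails.
Context {c sigma r : nat} {R : realType}.
Local Notation n := ((2 ^ r)%N%:R : R).
Implicit Types (gs : seq (@group c sigma)) (T : tabfun c sigma r).

Lemma invn_itv : 0 <= n^-1 <= 1.
Proof.
by rewrite invr_ge0 ler0n/= invf_le1 ?n_gt0// ler1n expn_gt0.
Qed.

(** Factor by factor, [1 - k/n <= (1 - 1/n)^k <= 1 - k/n + (k/n)^2]; as all factors lie in [[0, 1]],
    the errors simply add up. *)
Lemma survival_bounds gs :
  all (fun g : group => #|g.2| <= 2 ^ r)%N gs ->
  [/\ 0 <= survival r R gs, survival r R gs <= 1,
   survival r R gs <= (1 - n^-1) ^+ (\sum_(g <- gs) #|g.2|) &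
   (1 - n^-1) ^+ (\sum_(g <- gs) #|g.2|) <=
   survival r R gs + sumsq R gs * n^-1 ^+ 2].
Proof.
have /andP[i0 i1] := invn_itv.
elim: gs => [|g gs IH].
  by move=> _; rewrite /survival /sumsq !big_nil expr0 mul0r addr0.
move=> /(survival_factor R)[a0 a1 /IH[s0 s1 sq qs]].
rewrite /survival /sumsq !big_cons -/(survival r R gs) -/(sumsq R gs) exprD.
have q0 : 0 <= (1 - n^-1) ^+ #|g.2| by rewrite exprn_ge0// subr_ge0.
have q1 : (1 - n^-1) ^+ #|g.2| <= 1 by rewrite exprn_ile1// ?subr_ge0// gerBl.
have := bernoulli_ge #|g.2| invn_itv; have := bernoulli_le #|g.2| invn_itv.
rewrite exprMn.
have sq0 : 0 <= sumsq R gs * n^-1 ^+ 2.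
  by rewrite mulr_ge0 ?exprn_ge0// sumr_ge0// => h _; rewrite sqr_ge0.
have k0 : 0 <= #|g.2|%:R ^+ 2 * n^-1 ^+ 2 by rewrite mulr_ge0// exprn_ge0.
rewrite [(_ + sumsq R gs) * _]mulrDl.
move: (sumsq R gs * _) (_ * n^-1 ^+ 2) sq0 k0 qs => u w u0 w0.
move: (_ ^+ (\sum_(_ <- _) _)) (_ ^+ #|g.2|) (survival r R gs) q0 q1 a0 a1 s0 s1 sq.
move: (1 - _ / _) => a Q q s q0 q1 a0 a1 s0 s1 sQ Qs qa aq.
split; [by rewrite mulr_ge0|by rewrite mulr_ile1|exact: ler_pM|].
have := ler_wpM2l q0 Qs; have := ler_wpM2r s0 qa.
by have := ler_wpM2r u0 q1; have := ler_wpM2l w0 s1; nra.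
Qed.

Variables (X : {set key c sigma}) (gs : seq (@group c sigma)) (S t : R).
Hypotheses (lay : layered gs) (covX : covered gs = X).
Hypothesis sizeX : (\sum_(g <- gs) #|g.2|)%N = #|X|.
Hypotheses (sqS : sumsq R gs <= S) (S0 : 0 < S) (Sn : S < n ^+ 2) (t0 : 0 <= t).

(** Bounds both the gap between [n * survival] and [n (1 - 1/n)^m], and the mean number of
    collisions inside groups. *)
Let b := S / n.
Let bnd := expR (- t ^+ 2 / (2 * S)).

Lemma groups_le_n : all (fun g : group => #|g.2| <= 2 ^ r)%N gs.
Proof.
apply/allP => g ggs; rewrite -(ler_nat R) -(@ler_pXn2r _ 2%N) ?nnegrE//.
apply: le_trans (ltW Sn); apply: le_trans sqS.
rewrite /sumsq (perm_big _ (perm_to_rem ggs)) big_cons lerDl.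
by rewrite sumr_ge0// => h _; rewrite sqr_ge0.
Qed.

Lemma bias_sqr : b ^+ 2 <= S.
Proof.
rewrite /b expr_div_n ler_pdivrMr ?exprn_gt0 ?n_gt0// expr2.
by rewrite ler_wpM2l ?(ltW S0)// ltW.
Qed.

Lemma sumsq_expR (l : R) : expR (l ^+ 2 * sumsq R gs) <= expR (l ^+ 2 * S).
Proof. by rewrite ler_expR ler_wpM2l ?sqr_ge0. Qed.

(** The choice [l = t / S]. The bias costs [t b <= t^2 / 4 + b^2 <= t^2 / 4 + S]: the first term is
    what [s >= 7/4] leaves over, the second becomes the factor [expR 1]. *)
Lemma exponent_bound (s : R) : 7 / 4 <= s ->
  expR ((t / S) ^+ 2 * S) * expR (- (t / S * (s * t - b))) <= expR 1 * bnd.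
Proof.
move=> s74; rewrite -!expRD ler_expR.
have Sneq : S != 0 by rewrite gt_eqF.
have -> : (t / S) ^+ 2 * S + - (t / S * (s * t - b)) =
  (t ^+ 2 * (1 - s) + t * b) / S by field.
have -> : 1 + - t ^+ 2 / (2 * S) = (S - t ^+ 2 / 2) / S by field.
rewrite ler_wpM2r ?invr_ge0 ?(ltW S0)//.
have := ler_wpM2l (sqr_ge0 t) s74; have := sqr_ge0 (t / 2 - b).
by have := bias_sqr; lra.
Qed.

(** Chernoff's method: the event forces [n * survival - empty_bins >= 2 t - b]. *)
Lemma upper_tail :
  Pr_tab R (fun T : tabfun c sigma r =>
    mu0 R (2 ^ r) #|X| + 2 * t <= (image_size T X)%:R) <= expR 1 * bnd.
Proof.
have l0 : 0 <= t / S by rewrite divr_ge0// ltW.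
have [_ _ _ qs] := survival_bounds groups_le_n.
have s74 : 7 / 4 <= 2 :> R by rewrite ler_pdivrMr// -natrM ler_nat.
have mgf := avg_expR_survivalB_empty lay groups_le_n l0.
have {}mgf := le_trans mgf (sumsq_expR _).
have expo := ler_wpM2r (expR_ge0 (- (t / S * (2 * t - b)))) mgf.
apply: le_trans (le_trans expo (exponent_bound s74)).
rewrite [leRHS]mulrC -avgZ; apply: Pr_tab_markov => T.
  by rewrite mulr_ge0 ?expR_ge0.
rewrite /mu0 /image_size -covX => ET.
rewrite -expRD -[leLHS]expR0 ler_expR -mulrN -mulrDr mulr_ge0//.
move: ET; rewrite /empty_bins covX -sizeX.
have n0 : 0 < n := @n_gt0 r R.
have : n * (1 - n^-1) ^+ (\sum_(g <- gs) #|g.2|) <= n * survival r R gs + b.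
  apply: le_trans (ler_wpM2l (ltW n0) qs) _.
  rewrite mulrDr lerD2l /b expr2 mulrA mulrA [n * _]mulrC mulfK ?gt_eqF//.
  by rewrite ler_wpM2r ?invr_ge0// ltW.
rewrite mulrBr mulr1 {qs expo mgf}; move: (n * _ ^+ _) => q; lra.
Qed.

(** A single Markov test function adds an exponential term to a Chebyshev term for the centred
    collision count [D], which covers [D >= t / 4]. Otherwise [excess <= t / 4 + b], which leaves a
    deviation of [7/4 t - b]. *)
Lemma lower_tail : 0 < t ->
  Pr_tab R (fun T : tabfun c sigma r =>
    (image_size T X)%:R <= mu0 R (2 ^ r) #|X| - 2 * t) <=
  expR 1 * bnd + 16 * 3 ^+ c * (#|X|%:R ^+ 2 / (n * t ^+ 2)).
Proof.
move=> tgt0; have n0 : 0 < n := @n_gt0 r R.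
have l0 : 0 <= t / S by rewrite divr_ge0// ltW.
have [_ _ sq _] := survival_bounds groups_le_n.
pose D T := \sum_(p in group_pairs gs) coll_dev (R := R) p T.
have varD : avg (fun T => 16 / t ^+ 2 * D T ^+ 2) <=
    16 * 3 ^+ c * (#|X|%:R ^+ 2 / (n * t ^+ 2)).
  rewrite avgZ (le_trans (ler_wpM2l _ (collision_variance (X := X) _)))//.
  - by rewrite divr_ge0// sqr_ge0.
  - by move=> p /mem_group_pairs; rewrite covX.
  - by rewrite le_eqVlt; apply/orP; left; apply/eqP; field; rewrite !gt_eqF.
have mgf := avg_expR_emptyB_survival lay groups_le_n l0.
have {}mgf := le_trans mgf (sumsq_expR _).
have expo := ler_wpM2r (expR_ge0 (- (t / S * (7 / 4 * t - b)))) mgf.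
apply: le_trans (lerD (le_trans expo (exponent_bound (lexx _))) varD).
rewrite [X in _ <= X + _]mulrC -avgZ -avgD; apply: Pr_tab_markov => T.
  by rewrite addr_ge0// mulr_ge0 ?expR_ge0 ?sqr_ge0// divr_ge0// sqr_ge0.
rewrite /mu0 /image_size => ET.
have [Dt|Dt] := leP (t / 4) (D T).
  rewrite -[leLHS]add0r lerD ?mulr_ge0 ?expR_ge0//.
  rewrite mulrAC ler_pdivlMr ?exprn_gt0// mul1r.
  by move: (D T) Dt => d {ET varD expo mgf sq}; nra.
rewrite -[leLHS]addr0 lerD//; last first.
  by rewrite mulr_ge0 ?sqr_ge0// divr_ge0// sqr_ge0.
rewrite -expRD -[leLHS]expR0 ler_expR -mulrN -mulrDr mulr_ge0//.
have := excess_le_collisions (R := R) T lay.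
have -> : \sum_(p in group_pairs gs) (collide p T)%:R =
    D T + #|group_pairs gs|%:R / n.
  by rewrite /D sumrB sumr_const -[_ *+ _]mulr_natl subrK.
have Pb : #|group_pairs gs|%:R / n <= b.
  rewrite ler_wpM2r ?invr_ge0 ?(ltW n0)//.
  exact: le_trans (card_group_pairs lay) sqS.
move: ET; rewrite /empty_bins covX -sizeX.
have := ler_wpM2l (ltW n0) sq.
rewrite mulrBr mulr1 {sq varD expo mgf}; move: (n * _ ^+ _) => q; lra.
Qed.

End Tails.

(** * Assembling the bounds for an arbitrary key set *)

Lemma sumsq_le_powR {R : realType} c sigma (X : {set key c sigma})
    (gs : seq (@group c sigma)) : (0 < c)%N -> (0 < #|X|)%N ->
  (\sum_(g <- gs) #|g.2|)%N = #|X| ->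
  all (fun g : group => #|g.2| ^ c <= #|X| ^ c.-1)%N gs ->
  sumsq R gs <= #|X|%:R `^ (2 - c%:R^-1).
Proof.
move=> c0 X0 sz small.
have cn0 : c%:R != 0 :> R by rewrite pnatr_eq0 -lt0n.
have le1 g : g \in gs -> #|g.2|%:R <= #|X|%:R `^ (1 - c%:R^-1) :> R.
  move=> /(allP small) gX.
  have -> : #|g.2|%:R = (#|g.2|%:R ^+ c) `^ c%:R^-1 :> R.
    by rewrite -powR_mulrn// -powRrM divff// powRr1.
  have -> : #|X|%:R `^ (1 - c%:R^-1) = (#|X|%:R ^+ c.-1) `^ c%:R^-1 :> R.
    rewrite -powR_mulrn// -powRrM; congr (_ `^ _).
    by rewrite -subn1 natrB// mulrBl mul1r divff.
  by rewrite ge0_ler_powR ?nnegrE ?exprn_ge0 ?invr_ge0// -!natrX ler_nat.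
(* In each square one factor is bounded by the maximal group size, and the other factors sum to
   [m]. *)
have -> : #|X|%:R `^ (2 - c%:R^-1) = #|X|%:R * #|X|%:R `^ (1 - c%:R^-1) :> R.
  rewrite -{2}[#|X|%:R]powRr1// -powRD; first by congr (_ `^ _); ring.
  by apply/implyP => _; rewrite pnatr_eq0 -lt0n.
rewrite -{1}sz natr_sum mulr_suml /sumsq !big_seq; apply: ler_sum => g ggs.
by rewrite expr2 ler_wpM2l// le1.
Qed.

Lemma mu0_itv (R : realType) r m :
  0 <= mu0 R (2 ^ r) m <= (2 ^ r)%N%:R.
Proof.
have /andP[i0 i1] := @invn_itv r R.
have p0 : 0 <= (1 - (2 ^ r)%N%:R^-1 : R) ^+ m by rewrite exprn_ge0// subr_ge0.
have p1 : (1 - (2 ^ r)%N%:R^-1 : R) ^+ m <= 1.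
  by rewrite exprn_ile1// ?subr_ge0// gerBl.
rewrite /mu0 mulr_ge0 ?subr_ge0//=.
by rewrite ler_piMr// gerBl.
Qed.

Theorem theorem3 :
  forall (R : realType) (c : nat), (0 < c)%N ->
  exists K : R, 0 < K /\
  forall (sigma r : nat) (X : {set key c sigma}) (t : R), 0 <= t ->
    let m := #|X| in
    let n := (2 ^ r)%N in
    let bnd := expR (- (t ^+ 2) / (2 * (m%:R `^ (2 - (c%:R)^-1)))) in
    Pr_tab R (fun T : tabfun c sigma r =>
                mu0 R n m + 2 * t <= (image_size T X)%:R) <= K * bnd
    /\
    Pr_tab R (fun T : tabfun c sigma r =>
                (image_size T X)%:R <= mu0 R n m - 2 * t)
      <= K * (bnd + (m%:R ^+ 2) / (n%:R * t ^+ 2)).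
Proof.
move=> R c c0; exists (expR 1 + 16 * 3 ^+ c).
have C0 : 0 <= 16 * 3 ^+ c :> R by rewrite mulr_ge0// exprn_ge0.
have e0 : 0 < expR 1 :> R := expR_gt0 _.
split=> [|sigma r X t t0 m n bnd]; first by rewrite ltr_pwDl.
have b0 : 0 < bnd := expR_gt0 _.
have rest0 : 0 <= m%:R ^+ 2 / (n%:R * t ^+ 2) :> R.
  by rewrite divr_ge0 ?sqr_ge0// mulr_ge0 ?sqr_ge0.
suff [U L] : Pr_tab R (fun T : tabfun c sigma r =>
      mu0 R n m + 2 * t <= (image_size T X)%:R) <= expR 1 * bnd /\
    Pr_tab R (fun T : tabfun c sigma r =>
      (image_size T X)%:R <= mu0 R n m - 2 * t) <=
      expR 1 * bnd + 16 * 3 ^+ c * (m%:R ^+ 2 / (n%:R * t ^+ 2)).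
  split; first by rewrite (le_trans U)// ler_wpM2r ?lerDl// ltW.
  apply: le_trans L _; rewrite mulrDr; apply: lerD.
    by rewrite ler_wpM2r ?(ltW b0)// lerDl.
  by rewrite ler_wpM2r// lerDr ltW.
have trivial (E F : pred (tabfun c sigma r)) : 1 <= expR 1 * bnd -> Pr_tab R E <= expR 1 * bnd /\
    Pr_tab R F <= expR 1 * bnd + 16 * 3 ^+ c * (m%:R ^+ 2 / (n%:R * t ^+ 2)).
  move=> e1; split; first exact: le_trans (Pr_tab_le1 R E) e1.
  apply: le_trans (Pr_tab_le1 R F) _.
  by apply: ler_wpDr; [exact: mulr_ge0 C0 rest0|exact: e1].
have e1 : 1 <= expR 1 :> R by rewrite -[leLHS]expR0 ler_expR.
(* For [m = 0] the power is [0], and division by zero yields [0], so [bnd = 1]. *)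
have [m0|m0] := posnP m.
  apply: trivial; rewrite /bnd m0 powR0; last first.
    rewrite gt_eqF// subr_gt0 (@le_lt_trans _ _ 1)//; last by lra.
    by rewrite invf_le1 ?ltr0n ?ler1n.
  by rewrite mulr0 invr0 mulr0 expR0 mulr1.
have [gs [lay cov sz small]] := exists_layering X c0.
have S0 : 0 < m%:R `^ (2 - c%:R^-1) :> R by rewrite powR_gt0 ?ltr0n.
have sqS := sumsq_le_powR (R := R) c0 m0 sz small.
have [Sn|nS] := ltP (m%:R `^ (2 - c%:R^-1)) ((2 ^ r)%N%:R ^+ 2 : R).
  have [tz|tz] := eqVneq t 0.
    by apply: trivial; rewrite /bnd tz expr0n oppr0 mul0r expR0 mulr1.
  split; first exact: (upper_tail lay cov sz sqS S0 Sn t0).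
  by apply: (lower_tail lay cov sz sqS S0 Sn t0); rewrite lt_neqAle eq_sym tz.
(* Now [S >= n^2]. If [2 t <= n], then [t^2 / (2 S) <= 1/8] and the bound exceeds [1]; if [2 t > n],
   both events are impossible because [mu0] and the image size lie in [[0, n]]. *)
have [tn|nt] := leP (2 * t) n%:R.
  apply: trivial; rewrite /bnd -expRD -[leLHS]expR0 ler_expR mulNr subr_ge0.
  rewrite ler_pdivrMr ?mulr_gt0// mul1r.
  have : 0 <= n%:R :> R by [].
  move: nS tn t0; rewrite -/n; move: (_ `^ _) (n%:R) => S N.
  by clear; nra.
have /andP[mu_ge0 mu_len] := mu0_itv R r m.
have Pr0 (E : pred (tabfun c sigma r)) : (forall T, ~~ E T) -> Pr_tab R E = 0.
  move=> E0; rewrite Pr_tabE /avg big1 ?mul0r// => T _.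
  by rewrite (negbTE (E0 T)).
have eb0 : 0 <= expR 1 * bnd := ltW (mulr_gt0 e0 b0).
split.
  rewrite Pr0 => [//|T]; rewrite -ltNge.
  apply: le_lt_trans (card_hset_le R _) _.
  by rewrite (lt_le_trans nt)// lerDr.
rewrite Pr0 => [|T]; first exact: addr_ge0 eb0 (mulr_ge0 C0 rest0).
by rewrite -ltNge (@lt_le_trans _ _ 0)// subr_lt0 (le_lt_trans mu_len).
Qed.
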